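(* Let $\alpha$ be a real number with $\alpha \ge \dfrac{5}{\log 2+\frac12\log 3}$. Then for every integer $n>1$ we have $\|n\|\le \alpha\log n$.
   Context: For a positive integer $n$, $\|n\|$ (the integer complexity of $n$) denotes the smallest number of $1$s needed to write $n$ as an expression using only the number $1$, additions and multiplications (with arbitrary parentheses). $\log$ is the natural logarithm. *)

(* Defs.v *)
From Stdlib Require Import Reals Arith Lia Wf_nat Classical ClassicalEpsilon.

Inductive expr : Set :=
  | One : expr
  | Add : expr -> expr -> expr
  | Mul : expr -> expr -> expr.

Fixpoint value (e : expr) : nat :=
  match e with
  | One => 1
  | Add a b => value a + value b
  | Mul a b => value a * value b
  end.

Fixpoint ones (e : expr) : nat :=
  match e with
  | One => 1
  | Add a b => ones a + ones b
  | Mul a b => ones a + ones b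
  end.

Definition is_complexity (n k : nat) : Prop :=
  (exists e : expr, value e = n /\ ones e = k) /\
  (forall e : expr, value e = n -> k <= ones e).

(* Meaningful for [0 < n] only, by [complexity_spec]: no expression has
   value 0, so [complexity 0] is an unspecified number. *)
Definition complexity (n : nat) : nat :=
  epsilon (inhabits 0) (is_complexity n).

Lemma expr_exists (n : nat) : 0 < n -> exists e : expr, value e = n.
Proof.
  induction n as [|n IH]; [lia|].
  intros _. destruct n as [|n].
  - now exists One.
  - destruct IH as [e He]; [lia|].
    exists (Add One e). simpl. now rewrite He.
Qed.

Lemma complexity_spec (n : nat) : 0 < n -> is_complexity n (complexity n).
Proof.
  intros Hn. unfold complexity. apply epsilon_spec.
  destruct (expr_exists n Hn) as [e0 He0].
  destruct (dec_inh_nat_subset_has_unique_least_element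
              (fun k => exists e, value e = n /\ ones e = k))
    as [k [[Hk Hmin] _]].
  - intros k. apply classic.
  - exists (ones e0), e0. now split.
  - exists k. split; [exact Hk|].
    intros e He. apply Hmin. exists e. now split.
Qed.

(* Main.v *)
(** In exponential form the bound is [12^k <= n^10] ([cheap], with
    [2 * ln 2 + ln 3] for [ln 12]), proved by strong induction on [n].  If [n]
    is even, pass to [n/2].  If [n] is odd, write [n + 1 = 2^a * 3^b * s] with
    [s] prime to 6; there are two ways to peel digits off [n].
    - Removing [a - 1] binary digits 1 (three ones each) leaves [4 * j + 1]
      with [2 * j + 1 = 3^b * s], and the last [b] ternary digits of [j] are 1
      (four ones each).
    - The last [b] ternary digits of [n] are 2 (five ones each); after one
      more step the quotient is [-1/3] modulo a power of 2, so that its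
      last quaternary digits are 1 (five ones each).
    The first way is good enough when [a <= 2 * b].  When [a > 2 * b], the
    second way yields at least [b] quaternary digits, hence [10 * b] ones for a
    factor [12^b].  A chain must not end at 0, and at 1 the induction
    hypothesis fails ([ln 1 = 0]); in these cases the bound holds because the
    constants leave enough room. *)

Require Import Defs.
From Stdlib Require Import Reals.
From Stdlib Require Import Arith Lia Lra.
From Coquelicot Require Import Rcomplements.
Open Scope R_scope.

(** * Writing numbers by appending digits *)

Definition written (n k : nat) : Prop :=
  exists e : expr, value e = n /\ ones e = k.

Lemma written_1 : written 1 1.
Proof. now exists One. Qed.

Lemma written_add (m n k l : nat) :
  written m k -> written n l -> written (m + n) (k + l).
Proof.
  intros [e [He Hk]] [f [Hf Hl]]. exists (Add e f). simpl. lia.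
Qed.

Lemma written_mul (m n k l : nat) :
  written m k -> written n l -> written (m * n) (k + l).
Proof.
  intros [e [He Hk]] [f [Hf Hl]]. exists (Mul e f). simpl.
  split; congruence.
Qed.

Lemma written_2 : written 2 2.
Proof. exact (written_add 1 1 1 1 written_1 written_1). Qed.

Lemma written_3 : written 3 3.
Proof. exact (written_add 1 2 1 2 written_1 written_2). Qed.

Lemma written_4 : written 4 4.
Proof. exact (written_mul 2 2 2 2 written_2 written_2). Qed.

Lemma written_affine (d c m k r : nat) :
  written d c -> written m k -> written (d * m + r) (k + (c + r)).
Proof.
  intros Hd Hm. induction r as [|r IH].
  - replace (d * m + 0)%nat with (d * m)%nat by lia.
    replace (k + (c + 0))%nat with (c + k)%nat by lia.
    now apply written_mul.
  - replace (d * m + S r)%nat with (d * m + r + 1)%nat by lia.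
    replace (k + (c + S r))%nat with (k + (c + r) + 1)%nat by lia.
    apply written_add; [exact IH | exact written_1].
Qed.

(* [y] is [x] followed by [b] digits [r] in base [q + 1]; the equation is
   [y + r/q = (q + 1)^b * (x + r/q)], where [- r/q] is the fixed point of
   [x |-> (q + 1) * x + r]. *)
Lemma written_digits (q r c b x y k : nat) :
  (0 < q)%nat -> written (q + 1) c -> written x k ->
  (q * y + r = (q + 1) ^ b * (q * x + r))%nat ->
  written y (k + b * (c + r)).
Proof.
  intros Hq Hc. revert x k.
  induction b as [|b IH]; intros x k Hx Hy.
  - assert (y = x) as -> by (simpl in Hy; nia).
    now replace (k + 0 * (c + r))%nat with k by lia.
  - replace (k + S b * (c + r))%nat with (k + (c + r) + b * (c + r))%nat by lia.
    apply (IH ((q + 1) * x + r)%nat).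
    + now apply written_affine.
    + rewrite Hy, Nat.pow_succ_r'. ring.
Qed.

(** Take [j] to be [m] followed by [b] ternary digits 1; then [n] is [4 * j + 1] followed by [a]
    binary digits 1. One multiplication by 4 and the added 1 make up the final 5. *)
Lemma written_binary_ternary (a b m n k : nat) :
  (n + 1 = 2 ^ (a + 1) * 3 ^ b * (2 * m + 1))%nat -> written m k ->
  written n (k + 3 * a + 4 * b + 5).
Proof.
  intros Hn Hm.
  assert (exists j, (2 * j + 1 = 3 ^ b * (2 * m + 1))%nat) as [j Hj].
  { clear Hn. induction b as [|b [j Hj]].
    - exists m. simpl. lia.
    - exists (3 * j + 1)%nat. rewrite Nat.pow_succ_r'. lia. }
  assert (Hwj : written j (k + b * (3 + 1))).
  { apply (written_digits 2 1 3 b m); try assumption; [lia | exact written_3]. }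
  replace (k + 3 * a + 4 * b + 5)%nat
    with (k + b * (3 + 1) + (4 + 1) + a * (2 + 1))%nat by lia.
  apply (written_digits 1 1 2 a (4 * j + 1)); [lia | exact written_2 | |].
  - now apply written_affine; [exact written_4 |].
  - rewrite Nat.pow_add_r in Hn. simpl (1 + 1)%nat. simpl (2 ^ 1)%nat in Hn. nia.
Qed.

(** The witness is [x] followed by [c] quaternary digits 1, because
    [4 * (3 * j + 1) = 3 * (4 * j + 1) + 1]. *)
Lemma quaternary_ones (c x : nat) :
  exists j, (3 * j + 1 = 4 ^ c * (3 * x + 1))%nat.
Proof.
  induction c as [|c [j Hj]].
  - exists x. simpl. lia.
  - exists (4 * j + 1)%nat. rewrite Nat.pow_succ_r'. lia.
Qed.

(** Here [n + 1 = 3 ^ b * (3 * j + 1)], so [n] is [3 * j] followed by [b] ternary digits 2; the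
    factor 3 costs the final 3. *)
Lemma written_ternary_quaternary_odd (b c x n k : nat) :
  (n + 1 = 3 ^ b * 4 ^ c * (3 * x + 1))%nat -> written x k ->
  written n (k + 5 * b + 5 * c + 3).
Proof.
  intros Hn Hx. destruct (quaternary_ones c x) as [j Hj].
  assert (Hwj : written j (k + c * (4 + 1))).
  { apply (written_digits 3 1 4 c x); try assumption; [lia | exact written_4]. }
  replace (k + 5 * b + 5 * c + 3)%nat
    with (k + c * (4 + 1) + (3 + 0) + b * (3 + 2))%nat by lia.
  apply (written_digits 2 2 3 b (3 * j + 0)); [lia | exact written_3 | |].
  - now apply written_affine; [exact written_3 |].
  - simpl (2 + 1)%nat. nia.
Qed.

(** The extra factor 2 changes the intermediate number to [6 * j + 1], which costs 5 + 1 ones beyond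
    those of [j]. *)
Lemma written_ternary_quaternary_even (b c x n k : nat) :
  (n + 1 = 2 * 3 ^ b * 4 ^ c * (3 * x + 1))%nat -> written x k ->
  written n (k + 5 * b + 5 * c + 6).
Proof.
  intros Hn Hx. destruct (quaternary_ones c x) as [j Hj].
  assert (Hwj : written j (k + c * (4 + 1))).
  { apply (written_digits 3 1 4 c x); try assumption; [lia | exact written_4]. }
  replace (k + 5 * b + 5 * c + 6)%nat
    with (k + c * (4 + 1) + (5 + 1) + b * (3 + 2))%nat by lia.
  apply (written_digits 2 2 3 b (6 * j + 1)); [lia | exact written_3 | |].
  - apply written_affine; [|assumption].
    exact (written_mul 2 3 2 3 written_2 written_3).
  - simpl (2 + 1)%nat. nia.
Qed.

(** * Exact powers and logarithm estimates *)

Lemma factor_out (p n : nat) :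
  (1 < p)%nat -> (0 < n)%nat ->
  exists a s, (n = p ^ a * s)%nat /\ (s mod p <> 0)%nat.
Proof.
  intros Hp. induction n as [n IH] using lt_wf_ind. intros Hn.
  destruct (Nat.eq_dec (n mod p) 0) as [H0 | H0].
  - apply Nat.Div0.mod_divides in H0. destruct H0 as [m Hm].
    destruct (IH m) as [a [s [Hs Hsp]]]; [nia | nia |].
    exists (S a), s. split; [|exact Hsp].
    rewrite Nat.pow_succ_r', Hm, Hs. ring.
  - exists 0%nat, n. split; [simpl; lia | exact H0].
Qed.

Lemma ln_pow_le (x y : R) (p q : nat) :
  0 < x -> 0 < y -> x ^ p <= y ^ q -> INR p * ln x <= INR q * ln y.
Proof.
  intros Hx Hy H. rewrite <- !ln_pow by assumption.
  apply ln_le; [now apply pow_lt | exact H].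
Qed.

Lemma ln2_pos : 0 < ln 2.
Proof. rewrite <- ln_1. apply ln_increasing; lra. Qed.

Lemma ln3_le_2ln2 : ln 3 <= 2 * ln 2.
Proof.
  pose proof (ln_pow_le 3 2 1 2 ltac:(lra) ltac:(lra) ltac:(lra)) as H.
  simpl in H. lra.
Qed.

(** From 16 <= 27. The slack [3 * ln 3 - 4 * ln 2] is the loss per binary digit 1 and half the gain
    per ternary digit 1. *)
Lemma ln2_ln3 : 4 * ln 2 <= 3 * ln 3.
Proof.
  pose proof (ln_pow_le 2 3 4 3 ltac:(lra) ltac:(lra) ltac:(lra)) as H.
  simpl in H. lra.
Qed.

(** From 8503056 <= 9765625. This is the room needed by chains that would end at 0. *)
Lemma ln2_ln3_ln5 : 4 * ln 2 + 12 * ln 3 <= 10 * ln 5.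
Proof.
  assert (H : ln (2 ^ 4 * 3 ^ 12) <= ln (5 ^ 10)) by (apply ln_le; lra).
  rewrite ln_mult, !ln_pow in H by lra. simpl in H. lra.
Qed.

Lemma ln_12_pow (b : nat) : ln (12 ^ b) = INR b * (2 * ln 2 + ln 3).
Proof.
  rewrite ln_pow by lra. replace 12 with (2 ^ 2 * 3) by lra.
  rewrite ln_mult, ln_pow by lra. simpl. lra.
Qed.

(** * The bound for each way of peeling off digits *)

Definition cheap (n : nat) : Prop :=
  exists k, written n k /\ INR k * (2 * ln 2 + ln 3) <= 10 * ln (INR n).

Lemma cheap_even (m : nat) : (1 < m)%nat -> cheap m -> cheap (2 * m).
Proof.
  intros Hm [k [Hk Hln]].
  exists (2 + k)%nat. split; [now apply written_mul; [exact written_2 |]|].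
  rewrite plus_INR, mult_INR, ln_mult; try (apply lt_0_INR; lia).
  change (INR 2) with 2. pose proof ln2_pos. pose proof ln3_le_2ln2.
  lra.
Qed.

Lemma cheap_2 : cheap 2.
Proof.
  exists 2%nat. split; [exact written_2 |].
  change (INR 2) with 2. pose proof ln2_pos. pose proof ln3_le_2ln2. lra.
Qed.

Lemma ln_prod3_le (c y z : R) (n : nat) :
  0 < c -> 0 < y -> 0 < z -> c * y * z <= INR n ->
  ln c + ln y + ln z <= ln (INR n).
Proof.
  intros Hc Hy Hz H.
  rewrite <- ln_mult, <- ln_mult; try assumption; [|now apply Rmult_lt_0_compat].
  apply ln_le; [|exact H]. now repeat apply Rmult_lt_0_compat.
Qed.

Lemma pow_12 (b : nat) : (12 ^ b = 3 ^ b * 4 ^ b)%nat.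
Proof. now rewrite <- Nat.pow_mul_l. Qed.

Lemma INR_pow_12 (b : nat) : INR (12 ^ b) = 12 ^ b.
Proof. rewrite pow_INR. f_equal. simpl. lra. Qed.

Lemma ln_6 : ln 6 = ln 2 + ln 3.
Proof. rewrite <- ln_mult by lra. now f_equal. Qed.

(** A ternary 2 and a quaternary 1 together cost 10 ones for a factor 12, which balances exactly.
    The 3 remaining ones are paid for by the factor 3 in [3 * 12 ^ b * x <= n]. *)
Lemma cheap_ternary_quaternary_odd (b x n : nat) :
  (n + 1 = 12 ^ b * (3 * x + 1))%nat -> (0 < x)%nat ->
  ((1 < x)%nat -> cheap x) -> cheap n.
Proof.
  intros Hn Hx IH.
  assert (Hpos : (12 ^ b <> 0)%nat) by (apply Nat.pow_nonzero; lia).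
  assert (Hln : ln 3 + ln (12 ^ b) + ln (INR x) <= ln (INR n)).
  { apply ln_prod3_le; [lra | apply pow_lt; lra | apply lt_0_INR; lia |].
    rewrite <- INR_pow_12. replace 3 with (INR 3) by (simpl; lra).
    rewrite <- !mult_INR. apply le_INR. nia. }
  rewrite ln_12_pow in Hln.
  pose proof ln2_pos. pose proof ln2_ln3.
  assert (Hw : exists k, written x k /\
      INR k * (2 * ln 2 + ln 3) + 3 * (2 * ln 2 + ln 3) <= 10 * (ln 3 + ln (INR x))).
  { destruct (Nat.eq_dec x 1) as [-> | Hx1].
    (* At [x = 1] the requirement is exactly [4 * ln 2 <= 3 * ln 3]. *)
    - exists 1%nat. split; [exact written_1 |]. simpl. rewrite ln_1. lra.
    - destruct IH as [k [Hk Hkx]]; [lia |]. exists k. split; [exact Hk | lra]. }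
  destruct Hw as [k [Hk Hkx]].
  exists (k + 5 * b + 5 * b + 3)%nat. split.
  - apply (written_ternary_quaternary_odd b b x); [|exact Hk].
    now rewrite <- pow_12.
  - rewrite !plus_INR, !mult_INR. simpl (INR 5). simpl (INR 3). lra.
Qed.

Lemma cheap_ternary_quaternary_even (b x n : nat) :
  (1 < n)%nat -> (n + 1 = 2 * 12 ^ b * (3 * x + 1))%nat ->
  ((1 < x)%nat -> cheap x) -> cheap n.
Proof.
  intros Hn1 Hn IH.
  pose proof ln2_pos. pose proof ln2_ln3. pose proof ln_6.
  destruct (Nat.eq_dec x 0) as [-> | Hx0].
  { destruct b as [|b]; [simpl in Hn; lia |].
    (* The chain stops at 1 instead of 0, saving one quaternary digit:
       [4 * (3 * 0 + 1) = 3 * 1 + 1]. *)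
    exists (1 + 5 * S b + 5 * b + 6)%nat. split.
    - apply (written_ternary_quaternary_even (S b) b 1); [|exact written_1].
      rewrite Hn, pow_12, !Nat.pow_succ_r'. ring.
    (* With [N = 12 ^ S b], [n = 2 * N - 1] is at least [5 / 3 * N] once [N >= 3]; the constant 5/3
       makes [ln2_ln3_ln5] exactly the inequality required. *)
    - assert (Hln : ln (5 / 3) + ln (12 ^ S b) + ln 1 <= ln (INR n)).
      { apply ln_prod3_le; [lra | apply pow_lt; lra | lra |].
        rewrite <- INR_pow_12.
        assert (H12 : (12 <= 12 ^ S b)%nat).
        { rewrite Nat.pow_succ_r'.
          assert (12 ^ b <> 0)%nat by (apply Nat.pow_nonzero; lia). lia. }
        apply le_INR in H12. apply (f_equal INR) in Hn.
        rewrite plus_INR, !mult_INR, plus_INR, mult_INR in Hn.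
        simpl (INR 0) in Hn. simpl (INR 1) in Hn. change (INR 2) with 2 in Hn.
        replace (INR 12) with 12 in H12 by (simpl; lra). lra. }
      rewrite ln_12_pow, ln_1, ln_div in Hln by lra.
      pose proof ln2_ln3_ln5.
      rewrite (S_INR b) in Hln. rewrite !plus_INR, !mult_INR, (S_INR b).
      simpl (INR 5). simpl (INR 6). simpl (INR 1). lra. }
  assert (Hpos : (12 ^ b <> 0)%nat) by (apply Nat.pow_nonzero; lia).
  assert (Hln : ln 6 + ln (12 ^ b) + ln (INR x) <= ln (INR n)).
  { apply ln_prod3_le; [lra | apply pow_lt; lra | apply lt_0_INR; lia |].
    rewrite <- INR_pow_12. replace 6 with (INR 6) by (simpl; lra).
    rewrite <- !mult_INR. apply le_INR. nia. }
  rewrite ln_12_pow in Hln.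
  assert (Hw : exists k, written x k /\
      INR k * (2 * ln 2 + ln 3) + 6 * (2 * ln 2 + ln 3) <= 10 * (ln 6 + ln (INR x))).
  { destruct (Nat.eq_dec x 1) as [-> | Hx1].
    - exists 1%nat. split; [exact written_1 |]. simpl. rewrite ln_1. lra.
    - destruct IH as [k [Hk Hkx]]; [lia |]. exists k. split; [exact Hk | lra]. }
  destruct Hw as [k [Hk Hkx]].
  exists (k + 5 * b + 5 * b + 6)%nat. split.
  - apply (written_ternary_quaternary_even b b x); [|exact Hk].
    rewrite Hn, pow_12. ring.
  - rewrite !plus_INR, !mult_INR. simpl (INR 5). simpl (INR 6). lra.
Qed.

Lemma cheap_binary_ternary (a b m n : nat) :
  (n + 1 = 2 ^ (a + 1) * 3 ^ b * (2 * m + 1))%nat -> (a + 1 <= 2 * b)%nat ->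
  m <> 1%nat -> ((1 < m)%nat -> cheap m) -> cheap n.
Proof.
  intros Hn Hab Hm1 IH.
  pose proof ln2_pos. pose proof ln2_ln3.
  (* The [a] binary digits lose [a] units of [3 * ln 3 - 4 * ln 2] and the [b] ternary digits gain
     [2 * b] units. The product is supplied because [lra] cannot form it. *)
  assert (Hu : 0 <= (2 * INR b - INR a - 1) * (3 * ln 3 - 4 * ln 2)).
  { apply Rmult_le_pos; [|lra]. apply le_INR in Hab.
    rewrite plus_INR, mult_INR in Hab. simpl (INR 1) in Hab. change (INR 2) with 2 in Hab. lra. }
  assert (H2 : (2 ^ a <> 0)%nat) by (apply Nat.pow_nonzero; lia).
  destruct (Nat.eq_dec m 0) as [-> | Hm0].
  - destruct b as [|b]; [lia |].
    assert (H3 : (3 ^ b <> 0)%nat) by (apply Nat.pow_nonzero; lia).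
    (* The chain stops at 1 instead of 0, one ternary digit earlier:
       [3 * (2 * 0 + 1) = 2 * 1 + 1]. *)
    exists (1 + 3 * a + 4 * b + 5)%nat. split.
    + apply (written_binary_ternary a b 1); [|exact written_1].
      rewrite Hn, Nat.pow_succ_r'. ring.
    (* Since [n + 1 >= 6], passing from [n + 1] to [n] loses at most the factor 5/6. *)
    + assert (Hln : ln (5 / 6) + ln (2 ^ (a + 1)) + ln (3 ^ S b) <= ln (INR n)).
      { apply ln_prod3_le; [lra | apply pow_lt; lra | apply pow_lt; lra |].
        assert (H6 : (6 <= n + 1)%nat).
        { rewrite Hn, Nat.pow_succ_r', Nat.pow_add_r. simpl (2 ^ 1)%nat. nia. }
        apply le_INR in H6. apply (f_equal INR) in Hn.
        rewrite plus_INR in H6, Hn. rewrite !mult_INR, !pow_INR in Hn.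
        replace (INR 3) with 3 in Hn by (simpl; lra).
        simpl (INR 1) in H6, Hn. simpl (INR (2 * 0 + 1)) in Hn. change (INR 2) with 2 in Hn.
        replace (INR 6) with 6 in H6 by (simpl; lra). lra. }
      rewrite ln_div, !ln_pow, ln_6 in Hln by lra.
      pose proof ln2_ln3_ln5.
      rewrite plus_INR, (S_INR b) in Hln. rewrite (S_INR b) in Hu.
      rewrite !plus_INR, !mult_INR.
      simpl (INR 5). simpl (INR 4). simpl (INR 3). simpl (INR 1) in *. lra.
  - destruct IH as [k [Hk Hkm]]; [lia |].
    assert (H3 : (3 ^ b <> 0)%nat) by (apply Nat.pow_nonzero; lia).
    exists (k + 3 * a + 4 * b + 5)%nat. split.
    + now apply (written_binary_ternary a b m).
    + assert (Hln : ln (2 ^ (a + 2)) + ln (3 ^ b) + ln (INR m) <= ln (INR n)).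
      { apply ln_prod3_le; try (apply pow_lt; lra); [apply lt_0_INR; lia |].
        replace 3 with (INR 3) by (simpl; lra). change 2 with (INR 2).
        rewrite <- !pow_INR, <- !mult_INR. apply le_INR.
        rewrite Nat.pow_add_r in Hn |- *.
        simpl (2 ^ 1)%nat in Hn. simpl (2 ^ 2)%nat. nia. }
      rewrite !ln_pow, plus_INR in Hln by lra.
      rewrite !plus_INR, !mult_INR.
      simpl (INR 5). simpl (INR 4). simpl (INR 3). change (INR 2) with 2 in Hln.
      pose proof ln3_le_2ln2. lra.
Qed.

(** * The strong induction *)

Lemma cheap_gt1 (n : nat) : (1 < n)%nat -> cheap n.
Proof.
  induction n as [n IH] using lt_wf_ind. intros Hn.
  destruct (factor_out 2 (n + 1)) as [a [t [Ht Ht2]]]; [lia | lia |].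
  destruct (factor_out 3 t) as [b [s [Hs Hs3]]]; [lia | nia |].
  assert (Hs2 : (s mod 2 <> 0)%nat).
  { intros H. apply Ht2. rewrite Hs, Nat.Div0.mul_mod, H, Nat.mul_0_r. reflexivity. }
  subst t.
  destruct a as [|a].
  - simpl (2 ^ 0)%nat in Ht.
    assert (Heven : (n mod 2 = 0)%nat).
    { rewrite Nat.mul_1_l in Ht. rewrite <- Ht in Ht2.
      pose proof (Nat.div_mod_eq n 2). pose proof (Nat.mod_upper_bound n 2).
      pose proof (Nat.div_mod_eq (n + 1) 2). pose proof (Nat.mod_upper_bound (n + 1) 2).
      lia. }
    apply Nat.Div0.mod_divides in Heven. destruct Heven as [m ->].
    destruct (Nat.eq_dec m 1) as [-> | Hm]; [exact cheap_2 |].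
    apply cheap_even; [lia |]. apply IH; lia.
  (* The exponent of 2 in [n + 1] is [a + 1]; compared with [2 * b], it decides which digits to peel
     off. *)
  - destruct (le_lt_dec (a + 1) (2 * b)) as [Hab | Hab].
    + pose proof (Nat.div_mod_eq s 2) as Hdiv. pose proof (Nat.mod_upper_bound s 2).
      replace (S a) with (a + 1)%nat in Ht by lia.
      assert (Hn' : (n + 1 = 2 ^ (a + 1) * 3 ^ b * (2 * (s / 2) + 1))%nat).
      { replace (2 * (s / 2) + 1)%nat with s by lia. lia. }
      apply (cheap_binary_ternary a b (s / 2)); try assumption.
      (* A chain ending at 1 would force [s = 3], but [s] is prime to 3. *)
      * intros H1. rewrite H1 in Hdiv. assert (s = 3)%nat as -> by lia. now apply Hs3.
      * intros H1. apply IH; [|exact H1].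
        assert (2 ^ (a + 1) * 3 ^ b <> 0)%nat
          by (apply Nat.neq_mul_0; split; apply Nat.pow_nonzero; lia).
        nia.
    + set (e := (a - 2 * b)%nat). set (M := (2 ^ e * s)%nat).
      assert (HM : (n + 1 = 12 ^ b * (2 * M))%nat).
      { rewrite Ht, pow_12. replace (S a) with (1 + 2 * b + e)%nat by lia.
        rewrite !Nat.pow_add_r, Nat.pow_mul_r. unfold M. simpl (2 ^ 1)%nat.
        simpl (2 ^ 2)%nat. ring. }
      assert (HM3 : (M mod 3 <> 0)%nat).
      { unfold M. clear - Hs3. induction e as [|e IHe].
        - now rewrite Nat.mul_1_l.
        - rewrite Nat.pow_succ_r'. revert IHe.
          rewrite <- Nat.mul_assoc. generalize (2 ^ e * s)%nat as z. intros z Hz.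
          pose proof (Nat.div_mod_eq z 3). pose proof (Nat.mod_upper_bound z 3).
          pose proof (Nat.div_mod_eq (2 * z) 3). pose proof (Nat.mod_upper_bound (2 * z) 3).
          lia. }
      clearbody M.
      assert (Hpos : (12 ^ b <> 0)%nat) by (apply Nat.pow_nonzero; lia).
      pose proof (Nat.div_mod_eq M 3). pose proof (Nat.mod_upper_bound M 3).
      assert (M mod 3 = 1 \/ M mod 3 = 2)%nat as [H1 | H2] by lia.
      * apply (cheap_ternary_quaternary_even b (M / 3)); [exact Hn | |].
        -- rewrite HM. replace M with (3 * (M / 3) + 1)%nat at 1 by lia. ring.
        -- intros Hx. apply IH; [nia | exact Hx].
      (* For [M = 3 * q + 2], [2 * M = 3 * (2 * q + 1) + 1]: the factor 2 is absorbed and the chain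
         ends at [2 * q + 1 > 0]. *)
      * apply (cheap_ternary_quaternary_odd b (2 * (M / 3) + 1)).
        -- rewrite HM. f_equal. lia.
        -- lia.
        -- intros Hx. apply IH; [nia | exact Hx].
Qed.

Theorem theorem4 (alpha : R) (halpha : alpha >= 5 / (ln 2 + 1 / 2 * ln 3)) :
  forall n : nat, (1 < n)%nat -> INR (complexity n) <= alpha * ln (INR n).
Proof.
  intros n Hn.
  destruct (cheap_gt1 n Hn) as [k [[e [He Hk]] Hln]].
  destruct (complexity_spec n ltac:(lia)) as [_ Hmin].
  assert (Hc : INR (complexity n) <= INR k)
    by (apply le_INR; rewrite <- Hk; now apply Hmin).
  pose proof ln2_pos. pose proof ln2_ln3.
  assert (Hlnn : 0 <= ln (INR n)).
  { rewrite <- ln_1. apply ln_le; [lra |]. apply (le_INR 1). lia. }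
  apply Rle_trans with (5 / (ln 2 + 1 / 2 * ln 3) * ln (INR n)).
  - apply Rle_trans with (INR k); [exact Hc |].
    replace (5 / (ln 2 + 1 / 2 * ln 3) * ln (INR n))
      with (10 * ln (INR n) / (2 * ln 2 + ln 3)) by (field; lra).
    apply Rle_div_r; lra.
  - apply Rmult_le_compat_r; lra.
Qed.
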